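(* For $s-q\ge1$, the $\Gamma$-bound and the Hadamard bound for the Data-Fusion problem satisfy $$\mathfrak{z}_{\Gamma}-\mathfrak{z}_{\mathcal{H}}\le\sum_{i=2}^{s-q}\log\left(\frac{d_1(I_p+GB^{-1}G^\top)}{d_i(I_p+GB^{-1}G^\top)}\right).$$
   Context: Let $G\in\mathbb{R}^{p\times m}$, $H\in\mathbb{R}^{q\times m}$, $B:=H^\top H$ positive definite, $P:=\{1,\dots,p\}$, and $s$ an integer with $0<s-q<p$. The Data-Fusion problem is $\max\{\operatorname{ldet}(B+G^\top\operatorname{Diag}(x)G):\mathbf{e}^\top x=s-q,\ x\in\{0,1\}^p\}$, where $\operatorname{ldet}$ is log-determinant, $\mathbf{e}$ the all-ones vector, $\operatorname{Diag}(x)$ the diagonal matrix with diagonal $x$. For a symmetric matrix $X$, $d_i(X)$ is the $i$-th largest diagonal entry. Empty sums are $0$. The $\Gamma$-function: for $\lambda\in\mathbb{R}_+^k$ with $\lambda_1\ge\dots\ge\lambda_k$ and an integer $t$ with $0<t\le k$, there is a unique integer $\iota$ with $0\le\iota<t$ such that $\lambda_\iota>\frac{1}{t-\iota}\sum_{\ell=\iota+1}^k\lambda_\ell\ge\lambda_{\iota+1}$, with the convention $\lambda_0=+\infty$. Define $\phi_t(\lambda):=\sum_{\ell=1}^{\iota}\log(\lambda_\ell)+(t-\iota)\log\big(\frac{1}{t-\iota}\sum_{\ell=\iota+1}^k\lambda_\ell\big)$, with $\log(0)=-\infty$. For a symmetric positive-semidefinite $k\times k$ matrix $X$, $\Gamma_t(X):=\phi_t(\lambda(X))$,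 where $\lambda(X)$ is the vector of eigenvalues of $X$ in nonincreasing order. $\Gamma$-bound: let $\Psi\Psi^\top$ be the Cholesky factorization of $I_p+GB^{-1}G^\top$ and $\psi_i^\top$ the $i$-th row of $\Psi$, $i\in P$. Then $$\mathfrak{z}_{\Gamma}:=\operatorname{ldet}(B)+\max\Big\{\Gamma_{s-q}\Big(\sum_{i\in P}z_i\psi_i\psi_i^\top\Big):\mathbf{e}^\top z=s-q,\ 0\le z_i\le1\ (i\in P)\Big\}.$$ Hadamard bound: let $LL^\top$ be the Cholesky factorization of $B$, let $\rho_i(GL^{-\top}):=\|G_{i\cdot}L^{-\top}\|_2$ for $i\in P$ ($G_{i\cdot}$ is row $i$ of $G$), and let $\tau$ be a bijection from $\{1,\dots,p\}$ to $P$ such that $\rho_{\tau(i)}(GL^{-\top})\ge\rho_{\tau(j)}(GL^{-\top})$ whenever $i\le j$. Then $\mathfrak{z}_{\mathcal{H}}:=\operatorname{ldet}(B)+\sum_{i=1}^{s-q}\log\big(1+\rho_{\tau(i)}^2(GL^{-\top})\big)$. *)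

(* Defs.v *)
(* MathComp + MathComp-Analysis, over an arbitrary realType. *)
From mathcomp Require Export all_boot all_order all_algebra perm.
From mathcomp Require Export all_classical all_reals all_analysis.
From mathcomp Require Import lra.

Set Implicit Arguments.
Unset Strict Implicit.
Unset Printing Implicit Defensive.

Export Order.TTheory GRing.Theory Num.Theory.

Local Open Scope classical_set_scope.
Local Open Scope ring_scope.

Section Matrices.
Context {R : realType}.

Definition posdef n (A : 'M[R]_n) : Prop :=
  A^T = A /\ forall x : 'cV[R]_n, x != 0 -> 0 < (x^T *m A *m x) 0 0.

Definition ldet n (A : 'M[R]_n) : R := ln (\det A).

(* A = L L^T; [is_trig_mx] is lower triangularity. *)
Definition is_cholesky n (A L : 'M[R]_n) : Prop :=
  [/\ is_trig_mx L, forall i, 0 < L i i & A = L *m L^T].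

(* The library norm on 'rV[R]_n is the sup norm. *)
Definition norm2 n (u : 'rV[R]_n) : R := Num.sqrt (\sum_j u 0 j ^+ 2).

(* d_i(X): i counts from 1. *)
Definition diag_rank n (X : 'M[R]_n) (i : nat) : R :=
  (sort >=%R [seq X j j | j <- enum 'I_n])`_(i.-1).

(* Eigenvalues with (algebraic) multiplicity, in nonincreasing order; the
   default [::] is taken only if the characteristic polynomial does not split
   over R, hence never for a symmetric matrix. *)
Definition eigvals n (X : 'M[R]_n) : seq R :=
  xget [::] [set lam : seq R |
    sorted >=%R lam /\ char_poly X = \prod_(x <- lam) ('X - x%:P)].

End Matrices.

(* Vectors lambda are sequences indexed from 0: lambda_l is lam`_(l.-1). *)
Section GammaFunction.
Context {R : realType}.
Implicit Types (lam : seq R) (t i : nat).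

Definition tail_mean lam t i : R :=
  (\sum_(i <= l < size lam) lam`_l) / (t - i)%:R.

(* [i == 0] encodes the convention lambda_0 = +oo. *)
Definition is_iota lam t i : bool :=
  [&& (i < t)%N, (i == 0)%N || (tail_mean lam t i < lam`_(i.-1))
    & lam`_i <= tail_mean lam t i].

Lemma is_iota_exists_unique lam t :
  sorted >=%R lam -> all (fun x => 0 <= x) lam -> (0 < t <= size lam)%N ->
  exists! i, is_iota lam t i.
Proof.
move=> slam lam0 /andP[t0 tk].
have nth0 i : 0 <= lam`_i.
  by case: (ltnP i (size lam)) => h; [exact: (allP lam0 _ (mem_nth 0 h))|rewrite nth_default].
have nthS i : lam`_i.+1 <= lam`_i.
  case: (ltnP i.+1 (size lam)) => h; last by rewrite (nth_default _ h).
  by have /(sortedP 0)/(_ _ h) := slam.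
have sumS i : (i < size lam)%N -> \sum_(i <= l < size lam) lam`_l =
    lam`_i + \sum_(i.+1 <= l < size lam) lam`_l.
  by move=> h; rewrite big_ltn.
have tmM i : (i < t)%N ->
    tail_mean lam t i * (t - i)%:R = \sum_(i <= l < size lam) lam`_l.
  by move=> h; rewrite /tail_mean divfK// pnatr_eq0 subn_eq0 -ltnNge.
have step i : (i.+1 < t)%N -> tail_mean lam t i * ((t - i.+1)%:R + 1) =
    lam`_i + tail_mean lam t i.+1 * (t - i.+1)%:R.
  move=> h; have it := ltnW h.
  by rewrite natr1 subnSK// !tmM// sumS// (leq_trans it tk).
have pos i : (i < t)%N -> 0 < (t - i)%:R :> R by move=> h; rewrite ltr0n subn_gt0.
pose Q i := (i < t)%N && (lam`_i <= tail_mean lam t i).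
have exQ : exists i, Q i.
  exists t.-1; rewrite /Q prednK// leqnn/= /tail_mean.
  rewrite -subn1 subKn// divr1 sumS ?subn1 ?prednK//.
  by rewrite lerDl sumr_ge0.
case: (ex_minnP exQ) => i /andP[it Qi] imin.
exists i; split.
  rewrite /is_iota it Qi andbT/=; case: i it Qi imin => [//|i] it Qi imin /=.
  have : ~~ Q i by apply/negP => /imin; rewrite ltnn.
  rewrite /Q (ltnW it)/= -ltNge => lti.
  have := step _ it; have := pos _ it => h e; nra.
move=> j /and3P[jt sj wj].
have ij : (i <= j)%N by apply: imin; rewrite /Q jt.
apply/eqP; rewrite eqn_leq ij/= leqNgt; apply/negP => ltij.
have up k : (i <= k)%N -> (k.+1 < t)%N -> lam`_k <= tail_mean lam t k ->
    lam`_k <= tail_mean lam t k.+1.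
  by move=> _ kt wk; have := step _ kt; have := pos _ kt => h e; nra.
have W k : (i + k < t)%N -> lam`_(i + k) <= tail_mean lam t (i + k).
  elim: k => [|k IH]; rewrite ?addn0// addnS => h.
  by apply: le_trans (nthS _) _; apply: up => //; [exact: leq_addr|exact/IH/ltnW].
case: j jt sj wj ij ltij => [//|j] jt sj wj _; rewrite ltnS => ij.
have := W (j - i)%N; rewrite subnKC// => /(_ (ltnW jt)) /(up j ij jt).
by rewrite leNgt; move: sj => /= ->.
Qed.

Definition gamma_iota lam t : nat := find (is_iota lam t) (iota 0 t).

(* [lne] is the extended logarithm, with lne 0 = -oo. *)
Definition phi t lam : \bar R :=
  let i := gamma_iota lam t in
  (\sum_(0 <= l < i) lne (lam`_l)%:E
   + (t - i)%:R%:E * lne (tail_mean lam t i)%:E)%E.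

Definition Gamma t n (X : 'M[R]_n) : \bar R := phi t (eigvals X).

End GammaFunction.

Section Bounds.
Context {R : realType} {p m q : nat}.
Implicit Types (G : 'M[R]_(p, m)) (H : 'M[R]_(q, m)) (Psi : 'M[R]_p).

Definition Bmx H : 'M[R]_m := H^T *m H.

(* I_p + G B^-1 G^T *)
Definition fusion_mx G H : 'M[R]_p := 1%:M + G *m invmx (Bmx H) *m G^T.

Definition Gamma_feasible (t : nat) : set 'rV[R]_p :=
  [set z | \sum_i z 0 i = t%:R /\ forall i, 0 <= z 0 i <= 1].

(* psi_i is the transpose of row i of Psi. *)
Definition Gamma_objective Psi (t : nat) (z : 'rV[R]_p) : \bar R :=
  Gamma t (\sum_i z 0 i *: ((row i Psi)^T *m row i Psi)).

(* The optimal value is written as an extended-real supremum, which agrees with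
   the maximum whenever the latter is attained (Gamma_bound_max below). *)
Definition Gamma_bound H Psi (s : nat) : \bar R :=
  ((ldet (Bmx H))%:E +
   ereal_sup (Gamma_objective Psi (s - q) @` Gamma_feasible (s - q)))%E.

Lemma Gamma_bound_max H Psi s z : Gamma_feasible (s - q) z ->
  (forall z', Gamma_feasible (s - q) z' ->
    (Gamma_objective Psi (s - q) z' <= Gamma_objective Psi (s - q) z)%E) ->
  Gamma_bound H Psi s =
    ((ldet (Bmx H))%:E + Gamma_objective Psi (s - q) z)%E.
Proof.
move=> zf zmax; congr (_ + _)%E; apply/eqP; rewrite eq_le; apply/andP; split.
  by apply: ge_ereal_sup => _ [z' /zmax + <-].
by apply: ereal_sup_ubound; exists z.
Qed.

(* rho_i(G L^-T) *)
Definition rho G (L : 'M[R]_m) (i : 'I_p) : R := norm2 (row i (G *m invmx L^T)).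

(* The permutation tau is indexed from 0. *)
Definition Hadamard_bound G H (L : 'M[R]_m) (tau : {perm 'I_p}) (s : nat) : R :=
  ldet (Bmx H) + \sum_(i < p | (i < s - q)%N) ln (1 + rho G L (tau i) ^+ 2).

End Bounds.

(* Main.v *)
(* The objective matrix X = \sum_i z_i psi_i psi_i^T has trace
   \sum_i z_i M_ii <= t c, where M = I_p + G B^-1 G^T = Psi Psi^T, c = d_1(M)
   and t = s - q. The arguments of the t logarithms in phi_t (with multiplicity)
   add up to the trace, so the tangent bound log x <= log c + x / c - 1 gives
   Gamma_t(X) <= t log c. Since 1 + rho_i^2 = M_ii, the Hadamard bound is
   ldet B + \sum_(i <= t) log d_i(M), and the difference is the claimed sum. *)
Require Import Defs.
From mathcomp Require Import ring lra.

Local Open Scope ring_scope.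

Section Eigenvalues.
Context {R : realType}.

(** Both sides are minus the coefficient of degree n - 1 of the characteristic polynomial; for n = 0
    both are empty sums. *)
Lemma sum_roots_char_poly n (X : 'M[R]_n) (lam : seq R) :
  char_poly X = \prod_(x <- lam) ('X - x%:P) -> \sum_(x <- lam) x = \tr X.
Proof.
move=> Xlam; have /eqP := size_char_poly X.
rewrite Xlam size_prod_XsubC eqSS => /eqP szlam.
case: n X Xlam szlam => [|n] X Xlam szlam.
  by rewrite (size0nil szlam) big_nil /mxtrace big_ord0.
apply: oppr_inj; rewrite -char_poly_trace// Xlam -{1}szlam.
by rewrite coefPn_prod_XsubC// szlam.
Qed.

(** On an eigenvector v the quadratic form equals a times the positive number v v^T. *)
Lemma eigenvalue_psd_ge0 n (X : 'M[R]_n) (a : R) :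
  (forall v : 'rV[R]_n, 0 <= (v *m X *m v^T) 0 0) -> eigenvalue X a -> 0 <= a.
Proof.
move=> Xpsd /eigenvalueP[v vX v0]; have := Xpsd v.
rewrite vX -scalemxAl mxE pmulr_lge0//.
have sqr_ge0_v j : true -> 0 <= v 0 j ^+ 2 by move=> _; exact: sqr_ge0.
have -> : (v *m v^T) 0 0 = \sum_j v 0 j ^+ 2.
  by rewrite mxE; apply: eq_bigr => j _; rewrite mxE expr2.
rewrite lt0r sumr_ge0// andbT psumr_eq0//.
apply: contra v0 => /allP vj0; apply/eqP/rowP => j; rewrite mxE.
by have := vj0 j (mem_index_enum j); rewrite sqrf_eq0 => /eqP.
Qed.

End Eigenvalues.

Section GammaUpperBound.
Context {R : realType}.
Implicit Types (lam : seq R) (c x : R).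

(** This is ln y <= y - 1 at y = x / c; for x <= 0 the left side is -oo. *)
Lemma lne_le_tangent c x : 0 < c -> (lne x%:E <= (ln c + x / c - 1)%:E)%E.
Proof.
move=> c0; rewrite /lne; case: (leP x 0) => [_|x0]; first exact: leNye.
have xc0 : 0 < x / c by rewrite divr_gt0.
rewrite lee_fin -{1}(divfK (lt0r_neq0 c0) x) lnM ?posrE//.
have := @le_ln1Dx R (x / c - 1); rewrite (_ : 1 + _ = x / c); last by ring.
by move: (x / c) xc0 => y y0 ln_le; have := ln_le ltac:(lra); lra.
Qed.

Lemma gamma_iotaP lam t :
  sorted >=%R lam -> all (fun x => 0 <= x) lam -> (0 < t <= size lam)%N ->
  is_iota lam t (gamma_iota lam t).
Proof.
move=> slam lam0 tlam.
have [i [lami _]] := is_iota_exists_unique slam lam0 tlam.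
have hasi : has (is_iota lam t) (iota 0 t).
  by apply/hasP; exists i; rewrite ?mem_iota//; case/and3P: lami.
have := nth_find 0%N hasi; rewrite nth_iota//.
by move: hasi; rewrite has_find size_iota.
Qed.

Lemma phi_le lam t c : 0 < c ->
  sorted >=%R lam -> all (fun x => 0 <= x) lam -> (0 < t <= size lam)%N ->
  \sum_(x <- lam) x <= t%:R * c -> (phi t lam <= (t%:R * ln c)%:E)%E.
Proof.
move=> c0 slam lam0 tlam sumlam.
have /and3P[it _ _] := gamma_iotaP _ _ slam lam0 tlam.
have [_ tsz] := andP tlam.
rewrite /phi; set i := gamma_iota lam t in it *.
have ti0 : 0 < (t - i)%:R :> R by rewrite ltr0n subn_gt0.
apply: (@le_trans _ _ (\sum_(0 <= l < i) (ln c + lam`_l / c - 1)%:E +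
    (t - i)%:R%:E * (ln c + tail_mean lam t i / c - 1)%:E)%E).
  apply: leeD; first by apply: lee_sum => l _; exact: lne_le_tangent.
  by apply: lee_wpmul2l; [rewrite lee_fin ltW|exact: lne_le_tangent].
rewrite sumEFin -EFinM -EFinD lee_fin.
(* The weight t - i cancels the denominator of the tail mean, so the weighted arguments of the
   logarithms add up to the sum of all of [lam]. *)
have tmean : (t - i)%:R * tail_mean lam t i = \sum_(i <= l < size lam) lam`_l.
  by rewrite /tail_mean mulrC divfK// lt0r_neq0.
have sum_split : \sum_(0 <= l < i) lam`_l + \sum_(i <= l < size lam) lam`_l
    <= t%:R * c.
  rewrite -big_cat_nat ?(leq_trans (ltnW it))//=.
  by rewrite -(big_nth 0 xpredT id).
have -> : \sum_(0 <= l < i) (ln c + lam`_l / c - 1) =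
    i%:R * (ln c - 1) + (\sum_(0 <= l < i) lam`_l) / c.
  rewrite mulr_suml; under eq_bigr do rewrite addrAC.
  by rewrite big_split/= sumr_const_nat subn0 mulr_natl.
(* After division by c, the weighted ratios total at most t, which the t terms -1 compensate. *)
move: sum_split; rewrite -tmean natrB ?(ltnW it)// -ler_pdivrMr// mulrDl.
move: (\sum_(0 <= l < i) lam`_l) (tail_mean lam t i) => S T /=.
rewrite -!mulrA; move: (S / c) (T / c) => s' t'.
by lra.
Qed.

(* The junk value [::] of [eigvals] is harmless here, so that the spectral
   theorem is not needed in [Gamma_le]. *)
Lemma phi_nil t : (0 < t)%N -> phi t ([::] : seq R) = -oo%E.
Proof.
move=> t0; have tail0 : tail_mean ([::] : seq R) t 0 = 0.
  by rewrite /tail_mean big_geq// mul0r.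
have -> : phi t ([::] : seq R) = (t%:R%:E * lne 0%:E)%E.
  rewrite /phi (_ : gamma_iota _ _ = 0%N) ?tail0 ?big_geq ?add0e ?subn0//.
  (* Index 0 already passes the test: the default entry and the tail mean are both 0. *)
  by rewrite /gamma_iota; case: t t0 tail0 => //= t _ tail0; rewrite /is_iota tail0 /= lexx.
by rewrite /lne lexx gt0_muleNy// lte_fin ltr0n.
Qed.

Lemma Gamma_le n (X : 'M[R]_n) t c : 0 < c ->
  (forall v : 'rV[R]_n, 0 <= (v *m X *m v^T) 0 0) -> (0 < t <= n)%N ->
  \tr X <= t%:R * c -> (Gamma t X <= (t%:R * ln c)%:E)%E.
Proof.
move=> c0 Xpsd tn trX; rewrite /Gamma /eigvals.
case: xgetP => [lam _ [slam Xlam]|_]; last first.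
  by have [t0 _] := andP tn; rewrite phi_nil ?leNye.
(* Comparing degrees gives n eigenvalues, hence t <= [size lam]. *)
have /eqP := size_char_poly X; rewrite Xlam size_prod_XsubC eqSS => /eqP szlam.
apply: phi_le; rewrite ?szlam ?(sum_roots_char_poly _ _ _ Xlam)//.
apply/allP => x xlam; apply: (eigenvalue_psd_ge0 _ _ _ Xpsd).
by rewrite eigenvalue_root_char Xlam root_prod_XsubC.
Qed.

End GammaUpperBound.

Section DiagonalEntries.
Context {R : realType}.

(** The diagonal read along [tau] is a sorted rearrangement of the diagonal, and such a
    rearrangement is unique. *)
Lemma diag_rank_perm n (X : 'M[R]_n) (tau : {perm 'I_n}) :
  (forall i j : 'I_n, (i <= j)%N -> X (tau j) (tau j) <= X (tau i) (tau i)) ->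
  forall i : 'I_n, diag_rank X i.+1 = X (tau i) (tau i).
Proof.
move=> Xtau i; rewrite /diag_rank /=.
have ge_trans : transitive (>=%R : rel R) by move=> x y z /[swap]; exact: le_trans.
have ge_anti : antisymmetric (>=%R : rel R) by move=> x y; rewrite andbC; exact: le_anti.
have ge_total : total (>=%R : rel R) by move=> x y; exact: le_total.
have nth_diag k (kn : (k < n)%N) (o := Ordinal kn) :
    [seq X (tau j) (tau j) | j <- enum 'I_n]`_k = X (tau o) (tau o).
  by rewrite (nth_map o) ?size_enum_ord// (nth_ord_enum o o).
have -> : sort >=%R [seq X j j | j <- enum 'I_n] =
    [seq X (tau j) (tau j) | j <- enum 'I_n].
  apply: (sorted_eq ge_trans ge_anti); first exact: sort_sorted.
    apply/(sortedP 0) => k; rewrite size_map size_enum_ord => kn.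
    by rewrite /= (nth_diag _ kn) (nth_diag _ (ltnW kn)); exact: Xtau.
  rewrite perm_sort (map_comp (fun j => X j j) tau).
  apply: perm_map; rewrite perm_sym; apply: uniq_perm.
  - by rewrite map_inj_uniq ?enum_uniq//; exact: perm_inj.
  - exact: enum_uniq.
  - move=> j; rewrite mem_enum; apply/mapP; exists ((tau^-1)%g j) => //.
      by rewrite mem_enum.
    by rewrite permKV.
by rewrite (nth_map i) ?size_enum_ord// nth_ord_enum.
Qed.

End DiagonalEntries.

Section FusionMatrix.
Context {R : realType}.

Lemma mulmx_tr_diag m n (A : 'M[R]_(m, n)) i :
  (A *m A^T) i i = \sum_j A i j ^+ 2.
Proof. by rewrite mxE; apply: eq_bigr => j _; rewrite mxE expr2. Qed.

Lemma invmx_cholesky n (A L : 'M[R]_n) : is_cholesky A L ->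
  invmx A = invmx L^T *m (invmx L^T)^T.
Proof.
move=> [trigL L0 ->].
have Lu : L \in unitmx.
  rewrite unitmxE det_trig// unitfE; apply/lt0r_neq0/prodr_gt0 => i _; exact: L0.
have LTu : L^T \in unitmx by rewrite unitmx_tr.
have LLu : L *m L^T \in unitmx by rewrite unitmx_mul Lu.
(* Put (L L^T)^-1 (L L^T) in front of L^-T L^-1 and cancel from the inside. *)
rewrite trmx_inv trmxK -[RHS](mulKmx LLu) -mulmxA (mulmxA L^T) mulmxV//.
by rewrite mul1mx mulmxV// mulmx1.
Qed.

(** G B^-1 G^T is the Gram matrix of the rows of G L^-T. *)
Lemma fusion_mx_diag p m q (G : 'M[R]_(p, m)) (H : 'M[R]_(q, m)) L i :
  is_cholesky (Bmx H) L -> fusion_mx G H i i = 1 + rho G L i ^+ 2.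
Proof.
move=> HL; rewrite /fusion_mx (invmx_cholesky _ _ _ HL) mulmxA -mulmxA -trmx_mul.
rewrite mxE mulmx_tr_diag mxE eqxx mulr1n /rho /norm2 sqr_sqrtr.
  by under [in RHS]eq_bigr do rewrite mxE.
by apply: sumr_ge0 => j _; exact: sqr_ge0.
Qed.

(** Each summand contributes z_i times the square of v psi_i. *)
Lemma sum_outer_psd p n (z : 'rV[R]_p) (Psi : 'M[R]_(p, n)) (v : 'rV[R]_n) :
  (forall i, 0 <= z 0 i) ->
  0 <= (v *m (\sum_i z 0 i *: ((row i Psi)^T *m row i Psi)) *m v^T) 0 0.
Proof.
move=> z0; rewrite mulmx_sumr mulmx_suml summxE sumr_ge0// => i _.
rewrite -scalemxAr -scalemxAl mxE mulr_ge0//.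
have -> : v *m ((row i Psi)^T *m row i Psi) *m v^T =
    (v *m (row i Psi)^T) *m (v *m (row i Psi)^T)^T.
  by rewrite trmx_mul trmxK !mulmxA.
by rewrite mulmx_tr_diag sumr_ge0// => j _; exact: sqr_ge0.
Qed.

Lemma trace_sum_outer p n (z : 'rV[R]_p) (Psi : 'M[R]_(p, n)) :
  \tr (\sum_i z 0 i *: ((row i Psi)^T *m row i Psi)) =
  \sum_i z 0 i * (Psi *m Psi^T) i i.
Proof.
rewrite raddf_sum; apply: eq_bigr => i _ /=.
rewrite mxtraceZ mxtrace_mulC mulmx_tr_diag /mxtrace big_ord1 mulmx_tr_diag.
by congr (_ * _); apply: eq_bigr => j _; rewrite mxE.
Qed.

Lemma Gamma_bound_le p m q s (G : 'M[R]_(p, m)) (H : 'M[R]_(q, m)) Psi c :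
  (0 < s - q <= p)%N -> is_cholesky (fusion_mx G H) Psi ->
  0 < c -> (forall i, fusion_mx G H i i <= c) ->
  (Gamma_bound H Psi s <= (ldet (Bmx H) + (s - q)%:R * ln c)%:E)%E.
Proof.
move=> tp [_ _ MPsi] c0 Mc; rewrite /Gamma_bound EFinD leeD2l//.
apply: ge_ereal_sup => _ [z [sumz z01] <-].
have z0 i : 0 <= z 0 i by case/andP: (z01 i).
apply: Gamma_le => // [v|]; first exact: sum_outer_psd.
rewrite trace_sum_outer -MPsi -sumz mulr_suml.
by apply: ler_sum => i _; rewrite ler_wpM2l.
Qed.

End FusionMatrix.

Theorem theorem22 (R : realType) (p m q s : nat)
    (G : 'M[R]_(p, m)) (H : 'M[R]_(q, m))
    (Psi : 'M[R]_p) (L : 'M[R]_m) (tau : {perm 'I_p})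
    (HB : posdef (Bmx H))
    (Hs : (0 < s - q < p)%N)
    (HPsi : is_cholesky (fusion_mx G H) Psi)
    (HL : is_cholesky (Bmx H) L)
    (Htau : forall i j : 'I_p, (i <= j)%N ->
       rho G L (tau j) <= rho G L (tau i)) :
  (Gamma_bound H Psi s - (Hadamard_bound G H L tau s)%:E
   <= (\sum_(2 <= i < (s - q).+1)
         ln (diag_rank (fusion_mx G H) 1 / diag_rank (fusion_mx G H) i))%:E)%E.
Proof.
have [t0 tp] := andP Hs.
have diagE i := fusion_mx_diag _ _ _ G _ _ i HL.
set M := fusion_mx G H in HPsi diagE *.
have Mtau (i j : 'I_p) : (i <= j)%N -> M (tau j) (tau j) <= M (tau i) (tau i).
  by move=> ij; rewrite !diagE lerD2l ler_pXn2r ?nnegrE ?sqrtr_ge0// Htau.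
have dE := diag_rank_perm _ _ _ Mtau.
have M0 i : 0 < M i i by rewrite diagE ltr_pwDl// sqr_ge0.
(* Index 0, at which [tau] picks a largest diagonal entry. *)
pose o : 'I_p := Ordinal (leq_ltn_trans (leq0n _) tp).
have d1E : diag_rank M 1 = M (tau o) (tau o) := dE o.
have Md1 i : M i i <= diag_rank M 1.
  by rewrite d1E -{1 2}(permKV tau i) Mtau.
have d10 : 0 < diag_rank M 1 by rewrite d1E.
rewrite leeBlDr//; apply: le_trans (Gamma_bound_le _ _ _ _ _ _ _ _ _ HPsi d10 Md1) _.
  by rewrite t0 ltnW.
rewrite -EFinD lee_fin /Hadamard_bound addrCA lerD2l.
have -> : \sum_(i < p | (i < s - q)%N) ln (1 + rho G L (tau i) ^+ 2) =
    \sum_(1 <= i < (s - q).+1) ln (diag_rank M i).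
  rewrite big_add1 big_mkord (big_ord_widen p (fun i => ln (diag_rank M i.+1))) 1?ltnW//=.
  by apply: eq_bigr => i _; rewrite dE diagE.
have d_gt0 i : (1 <= i < (s - q).+1)%N -> 0 < diag_rank M i.
  case: i => // i /andP[_ it].
  by rewrite (dE (Ordinal (ltn_trans (it : (i < s - q)%N) tp))).
(* Split ln d_1 off the Hadamard sum and merge the rest with the claimed sum: each ln (d_1 / d_i) +
   ln d_i is ln d_1, so t - 1 copies join the one split off. *)
rewrite [X in _ + X]big_ltn// addrCA -big_split/=.
rewrite (eq_big_nat _ _ (F2 := fun=> ln (diag_rank M 1))) => [|i /andP[i2 it]].
  rewrite sumr_const_nat -mulrS subSS subn1 prednK// mulr_natl.
  exact: lexx.
by rewrite ln_div ?posrE ?subrK// d_gt0// it (ltnW i2).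
Qed.
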